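(* Let $X_1$, $X_2$ be two Tychonoff spaces, $f:X_1\to X_2$ be a continuous function and $\beta f:\beta X_1\to\beta X_2$ be the extension of $f$ to the Stone–Čech compactifications of $X_1$ and $X_2$. Then: (a) $\beta f$ is quasi-open iff $f$ is skeletal; (b) $\beta f$ is an open map iff $f$ satisfies the following condition: (OB) for every $A,B\subseteq X_1$ which are completely separated in $X_1$, the sets $f(A)$ and $X_2\setminus\mathrm{cl}_{X_2}(f(X_1\setminus B))$ are completely separated in $X_2$; (c) (V. Z. Poljakov) if $X_1$ and $X_2$ are normal spaces, then $\beta f$ is open iff for every $A,B\subseteq X_1$ such that $\mathrm{cl}_{X_1}(A)\subseteq\mathrm{int}_{X_1}(B)$, the inclusion $\mathrm{cl}_{X_2}(f(A))\subseteq\mathrm{int}_{X_2}(\mathrm{cl}_{X_2}(f(B)))$ holds; (d) (A. D. Taĭmanov) if $X_1$ and $X_2$ are normal spaces and $f$ is an open and closed map, then $\beta f$ is open.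
   Context: A continuous map $f:X\to Y$ is quasi-open if $\mathrm{int}(f(U))\neq\emptyset$ for every non-empty open subset $U$ of $X$. A function $f:X\to Y$ is skeletal if $\mathrm{int}(f^{-1}(\mathrm{cl}(V)))\subseteq\mathrm{cl}(f^{-1}(V))$ for every open subset $V$ of $Y$. Open maps and closed maps are assumed to be continuous but are not assumed to be onto. Two subsets $A,B$ of a space $X$ are completely separated in $X$ if there is a continuous $h:X\to[0,1]$ with $h(A)\subseteq\{0\}$ and $h(B)\subseteq\{1\}$. Here $\mathrm{cl}_X$ and $\mathrm{int}_X$ denote closure and interior in $X$. *)

(* Defs.v *)
From HB Require Import structures.
From mathcomp Require Import all_boot all_order all_algebra.
From mathcomp Require Import all_classical all_reals all_analysis.

Set Implicit Arguments.
Unset Strict Implicit.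
Unset Printing Implicit Defensive.

Import Order.TTheory GRing.Theory Num.Theory.
Import numFieldNormedType.Exports.

Local Open Scope classical_set_scope.
Local Open Scope ring_scope.

(* [uniform_separatorP] identifies the library's [completely_regular_space]
   with separation of points from closed sets by [0, 1]-valued functions. *)
Definition tychonoff_space (X : topologicalType) : Prop :=
  completely_regular_space X /\ hausdorff_space X.

Definition quasi_open (X Y : topologicalType) (f : X -> Y) : Prop :=
  continuous f /\
  forall U : set X, open U -> U !=set0 -> interior (f @` U) !=set0.

Definition skeletal (X Y : topologicalType) (f : X -> Y) : Prop :=
  forall V : set Y, open V ->
    interior (f @^-1` closure V) `<=` closure (f @^-1` V).

Definition open_map (X Y : topologicalType) (f : X -> Y) : Prop :=
  continuous f /\ forall U : set X, open U -> open (f @` U).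

Definition closed_map (X Y : topologicalType) (f : X -> Y) : Prop :=
  continuous f /\ forall F : set X, closed F -> closed (f @` F).

Definition completely_separated (R : realType) (X : topologicalType)
    (A B : set X) : Prop :=
  exists h : X -> R, [/\ continuous h, range h `<=` `[0, 1],
    h @` A `<=` [set 0] & h @` B `<=` [set 1]].

Definition embedding (X Y : topologicalType) (e : X -> Y) : Prop :=
  injective e /\
  forall U : set X, open U <-> exists2 V : set Y, open V & U = e @^-1` V.

(* [e : X -> bX] is the Stone-Cech compactification of [X], characterized up to
   homeomorphism under [X] by its universal property; [stone_cech_exists] below
   provides one for every Tychonoff space. *)
Record stone_cech (X bX : topologicalType) (e : X -> bX) : Prop := StoneCech {
  stone_cech_compact : compact [set: bX];
  stone_cech_hausdorff : hausdorff_space bX;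
  stone_cech_embedding : embedding e;
  stone_cech_dense : dense (range e);
  stone_cech_extend : forall (K : topologicalType) (g : X -> K),
    compact [set: K] -> hausdorff_space K -> continuous g ->
    exists2 G : bX -> K, continuous G & forall x, G (e x) = g x }.

(* Uniqueness of [bf] is [stone_cech_extension_unique]. *)
Definition stone_cech_extension (X1 X2 bX1 bX2 : topologicalType)
    (e1 : X1 -> bX1) (e2 : X2 -> bX2) (f : X1 -> X2) (bf : bX1 -> bX2) : Prop :=
  continuous bf /\ forall x, bf (e1 x) = e2 (f x).

Lemma embedding_continuous (X Y : topologicalType) (e : X -> Y) :
  embedding e -> continuous e.
Proof. by case=> _ eo; apply/continuousP => V oV; apply/eo; exists V. Qed.

Lemma stone_cech_extension_exists (X1 X2 bX1 bX2 : topologicalType)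
    (e1 : X1 -> bX1) (e2 : X2 -> bX2) (f : X1 -> X2) :
  stone_cech e1 -> stone_cech e2 -> continuous f ->
  exists bf : bX1 -> bX2, stone_cech_extension e1 e2 f bf.
Proof.
move=> [_ _ _ _ ext] [cp2 hs2 em2 _ _] cf.
have [|bf cbf bfE] := ext bX2 (e2 \o f) cp2 hs2.
  move=> x; apply: continuous_comp; first exact: cf.
  exact: embedding_continuous.
by exists bf.
Qed.

Lemma stone_cech_extension_unique (X1 X2 bX1 bX2 : topologicalType)
    (e1 : X1 -> bX1) (e2 : X2 -> bX2) (f : X1 -> X2) (bf bf' : bX1 -> bX2) :
  stone_cech e1 -> stone_cech e2 ->
  stone_cech_extension e1 e2 f bf -> stone_cech_extension e1 e2 f bf' ->
  bf = bf'.
Proof.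
move=> [_ _ _ d1 _] [_ hs2 _ _ _] [c E] [c2 E2]; apply/funext => y.
apply: hs2 => A B /c nA /c2 nB.
have nAB : nbhs y (bf @^-1` A `&` bf' @^-1` B) by exact: filterI.
have [W [oW Wy] WAB] : exists2 W, open_nbhs y W &
    W `<=` bf @^-1` A `&` bf' @^-1` B.
  by move: nAB; rewrite nbhsE => -[W]; exists W.
have [|z [/WAB[/= Az Bz] [x _ xE]]] := d1 W _ oW; first by exists y.
by exists (e2 (f x)); move: Az Bz; rewrite -xE E E2.
Qed.

Section stone_cech_existence.
Variable R : realType.

Definition unit_fun (X : topologicalType) : choiceType :=
  {classic {g : X -> R | continuous g /\ range g `<=` `[0, 1]}}.

Definition cube (X : topologicalType) : topologicalType :=
  prod_topology (fun _ : unit_fun X => R : topologicalType).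

Definition to_cube (X : topologicalType) : X -> cube X :=
  @join_product (unit_fun X) X (fun=> R) (fun g => sval g).

Lemma unit_fun_separate (X : topologicalType) : completely_regular_space X ->
  @separate_points_from_closed (unit_fun X) X (fun=> R) (fun g => sval g).
Proof.
move=> cr U x cU Ux.
have /(@uniform_separatorP _ R)[h [ch h01 h0 h1]] := cr x U cU Ux.
exists (exist _ h (conj ch h01)) => /= clx.
have /closure_id c1 : closed [set (1 : R)].
  exact/accessible_closed_set1/hausdorff_accessible/Rhausdorff.
have : [set (1:R)] (h x) by rewrite c1; exact: (closureS h1).
have -> : h x = 0 by apply: h0; exists x.
by move=> /= /esym/eqP; rewrite oner_eq0.
Qed.

Lemma unit_fun_continuous (X : topologicalType) (g : unit_fun X) :
  continuous (sval g : X -> R).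
Proof. by case: g => g []. Qed.

Lemma to_cube_embedding (X : topologicalType) :
  tychonoff_space X -> embedding (@to_cube X).
Proof.
move=> [cr hs].
have inj : set_inj [set: X] (@to_cube X).
  apply: join_product_inj; [exact: unit_fun_separate|exact: hausdorff_accessible].
split; first by move=> x y; apply: inj; exact: in_setT.
move=> U; rewrite (join_product_initial (unit_fun_separate cr)
  (@unit_fun_continuous X) inj).
by split=> [[V oV <-]|[V oV ->]]; exists V.
Qed.

Lemma cube_hausdorff (X : topologicalType) : hausdorff_space (cube X).
Proof.
apply: (@hausdorff_product (unit_fun X) (fun=> R : topologicalType)) => ?.
exact: Rhausdorff.
Qed.

Lemma closure_to_cube_compact (X : topologicalType) :
  compact (closure (range (@to_cube X))).
Proof.
have cC : compact [set p : cube X | forall g, `[(0:R), 1]%classic (p g)].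
  apply: (@tychonoff (unit_fun X) (fun=> R : topologicalType)
    (fun=> `[(0:R), 1]%classic)) => ?.
  exact: segment_compact.
apply: (subclosed_compact _ cC); first exact: closed_closure.
have /closure_id -> := compact_closed (@cube_hausdorff X) cC.
by apply: closureS => _ [x _ <-] [g [cg g01]] /=; apply: g01; exists x.
Qed.

Lemma set_type_compact (T : topologicalType) (A : set T) :
  compact A -> compact [set: set_type A].
Proof.
move=> cA F PF _.
have FA : (set_val @ F) A.
  by rewrite /fmap /=; apply: filterE => -[x xA]; exact: set_mem.
have [p [Ap clp]] := cA _ (fmap_proper_filter _ PF) FA.
exists (exist _ p (mem_set Ap)); split => // B C FB [_ [[W oW <-] /= Wp] WC].
have [|_ [[b Bb <-] Wb]] := clp (set_val @` B) W _ (open_nbhs_nbhs (conj oW Wp)).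
  by apply: (@filterS _ F _ B) => // b Bb; exists b.
by exists b; split => //; exact: WC.
Qed.

Lemma set_type_hausdorff (T : topologicalType) (A : set T) :
  hausdorff_space T -> hausdorff_space (set_type A).
Proof.
move=> hs p q clpq; apply: val_inj; apply: hs => B C nB nC.
have cv := @initial_continuous (set_type A) T set_val.
have [z [Bz Cz]] := clpq _ _ (cv p _ nB) (cv q _ nC).
by exists (set_val z).
Qed.

Definition cube_comp (X K : topologicalType) (g : X -> K) (cg : continuous g)
    (h : unit_fun K) : unit_fun X.
Proof.
exists (sval h \o g); case: h => h [ch h01] /=; split.
  by move=> x; apply: continuous_comp; [exact: cg|exact: ch].
by move=> _ [x _ <-]; apply: h01; exists (g x).
Defined.

Definition cube_map (X K : topologicalType) (g : X -> K) (cg : continuous g)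
  (p : cube X) : cube K := fun h => p (cube_comp cg h).

Lemma prod_continuous (T U : topologicalType) (I : choiceType)
    (f : T -> prod_topology (fun _ : I => U)) :
  (forall i, continuous (fun t => f t i)) -> continuous f.
Proof.
move=> cf x; apply/cvg_sup => i; move: x.
apply/(@continuousP _ (initial_topology (@^~ i))) => _ [B oB <-].
by move: B oB; apply/continuousP; exact: cf.
Qed.

Lemma cube_map_continuous (X K : topologicalType) (g : X -> K)
  (cg : continuous g) : continuous (cube_map cg).
Proof.
apply: prod_continuous => h.
exact: (@proj_continuous (unit_fun X) (fun=> R) (cube_comp cg h)).
Qed.

Theorem stone_cech_exists (X : topologicalType) : tychonoff_space X ->
  exists (bX : topologicalType) (e : X -> bX), stone_cech e.
Proof.
move=> tX; set A := closure (range (@to_cube X)).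
have Aj x : to_cube x \in A by apply/mem_set/subset_closure; exists x.
have [inj jo] := to_cube_embedding tX.
exists (set_type A), (fun x => exist _ (to_cube x) (Aj x)); split.
- exact/set_type_compact/closure_to_cube_compact.
- exact/set_type_hausdorff/cube_hausdorff.
- split=> [x y /(congr1 val)/inj//|U].
  split=> [/jo[V oV ->]|[_ [V oV <-] ->]].
    by exists (set_val @^-1` V) => //; exists V.
  by apply/jo; exists V.
- move=> V [[p pA] Vp] [W oW WE]; have Wp : W p by move: Vp; rewrite -WE.
  have [_ [[x _ <-] Wx]] := set_mem pA W (open_nbhs_nbhs (conj oW Wp)).
  by exists (exist _ (to_cube x) (Aj x)); rewrite -WE; split => //; exists x.
move=> K g cK hK cg.
have tK : tychonoff_space K.
  split=> //; apply: (@normal_completely_regular R).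
    exact: compact_normal.
  exact: hausdorff_accessible.
have [injK Ko] := to_cube_embedding tK.
have cKj : continuous (@to_cube K) by exact/embedding_continuous/to_cube_embedding.
have clK : closed (range (@to_cube K)).
  apply: compact_closed; first exact: cube_hausdorff.
  by apply: continuous_compact => //; exact: continuous_subspaceT.
have im (y : set_type A) : exists k, to_cube k = cube_map cg (set_val y).
  suff [k _ kE] : range (@to_cube K) (cube_map cg (set_val y)) by exists k.
  case: y => p pA; apply: clK => B.
  move=> /(@cube_map_continuous _ _ _ cg)/(set_mem pA)[_ [[x _ <-] Bx]].
  by exists (to_cube (g x)); split; [exists (g x)|exact: Bx].
exists (fun y => sval (cid (im y))); last first.
  by move=> x; apply: injK; case: cid.
apply/continuousP => V /Ko[W oW ->].
suff -> : (fun y => sval (cid (im y))) @^-1` (@to_cube K @^-1` W) =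
    set_val @^-1` (cube_map cg @^-1` W).
  exists (cube_map cg @^-1` W) => //.
  by move: W oW; apply/continuousP; exact: cube_map_continuous.
by apply/seteqP; split => y /=; case: cid => /= k ->.
Qed.

End stone_cech_existence.

(* Main.v *)
Require Import Defs.
From mathcomp Require Import all_boot all_order all_algebra.
From mathcomp Require Import all_classical all_reals all_analysis.

Import numFieldNormedType.Exports.

Local Open Scope classical_set_scope.

(** Let [F : K1 -> K2] be a continuous extension of [f : X1 -> X2] to Hausdorff
    compactifications. Since [K1] is compact, [F] is a closed map, so it sends
    the closure of a subset [A] of [X1] onto the closure of [f @` A]. Openness
    properties of [F] can then be tested on such closures, as every open set of
    [K1] lies in the closure of its trace on [X1]. Two subsets of [X1] are
    called far when their closures in [K1] are disjoint, and likewise for [X2].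

    - [F] is quasi-open iff [f] is skeletal. If skeletality fails at [V], some
      non-empty open set of [X1] misses the preimage of [V] but is mapped into
      the closure of [V]; the image under [F] of the corresponding open set of
      [K1] then has no interior point. If quasi-openness fails at a small
      closed neighbourhood [C], then the complement of [F @` C] is open and
      dense, and its trace on [X2] violates skeletality of [f].
    - [F] is open iff [f] sends far pairs [A], [B] to far pairs [f @` A],
      [~` closure (f @` (~` B))] ([open_extension_farP]): this says that
      whenever the closure of [~` B] is a neighbourhood of that of [A], its
      image under [F] is a neighbourhood of the image of the closure of [A].

    In a Stone-Cech compactification, far means completely separated
    ([stone_cech_farP]): separating functions extend by the universal property
    in one direction, and come from Urysohn's lemma in the compact Hausdorff
    space [K] in the other. This gives (OB). In a normal space, completely
    separated means having disjoint closures, and (OB) becomes Poljakov's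
    condition after replacing [B] by its complement. Open and closed maps
    satisfy that condition because [f @` closure A] is closed and
    [f @` interior B] is open. *)

(** * Hausdorff compactifications *)

(** The part of [stone_cech] that does not mention the universal property. *)
Record compactification {X K : topologicalType} (e : X -> K) : Prop := {
  compactification_compact : compact [set: K];
  compactification_hausdorff : hausdorff_space K;
  compactification_embedding : embedding e;
  compactification_dense : dense (range e) }.

(** The farness relation of the Efremovich proximity that [K] induces on
    [X]. *)
Definition far {X K : topologicalType} (e : X -> K) (A B : set X) : Prop :=
  closure (e @` A) `&` closure (e @` B) = set0.

Lemma stone_cech_compactification {X K : topologicalType} {e : X -> K} :
  stone_cech e -> compactification e.
Proof. by case. Qed.

(** * Closures and compact Hausdorff spaces *)

Lemma closure_sub_closed {X : topologicalType} {A F : set X} :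
  closed F -> A `<=` F -> closure A `<=` F.
Proof. by move=> /closure_id clF /closureS; rewrite -clF. Qed.

Lemma open_meets_closure {X : topologicalType} {A W : set X} :
  open W -> W `&` closure A !=set0 -> W `&` A !=set0.
Proof.
move=> oW [x [Wx /(_ W) clAx]].
by rewrite setIC; apply: clAx; exact: open_nbhs_nbhs.
Qed.

Lemma image_closure_sub {X Y : topologicalType} {g : X -> Y} {A : set X} :
  continuous g -> g @` closure A `<=` closure (g @` A).
Proof.
move=> /continuous_closedP cg; apply/image_subP.
apply: (closure_sub_closed (F := g @^-1` closure (g @` A))).
  by apply: cg; exact: closed_closure.
by move=> x Ax; apply: subset_closure; exists x.
Qed.

Lemma compact_closed_map {X Y : topologicalType} {g : X -> Y} :
  compact [set: X] -> hausdorff_space Y -> continuous g -> closed_map g.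
Proof.
move=> cX hY cg; split=> // F cF; apply: compact_closed => //.
apply: continuous_compact; first exact: continuous_subspaceT.
exact: (subclosed_compact cF cX).
Qed.

(** Regularity of compact Hausdorff spaces, with an open set as witness. *)
Lemma compact_hausdorff_shrink {X : topologicalType} {x : X} {U : set X} :
  compact [set: X] -> hausdorff_space X -> open U -> U x ->
  exists V : set X, [/\ open V, V x & closure V `<=` U].
Proof.
move=> cX hX oU Ux.
have clx : closed [set x] by exact/accessible_closed_set1/hausdorff_accessible.
have [|V nV VU] := compact_normal hX cX clx (t := U).
  by move=> _ ->; exact: open_nbhs_nbhs.
exists V°; split; first exact: open_interior.
  by apply: nV.
by apply: subset_trans VU; apply: closureS; exact: interior_subset.
Qed.

(** Density makes an open set of [K] recoverable, up to closure, from its trace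
    on [X]. *)
Lemma open_sub_closure_trace {X K : topologicalType} {e : X -> K} {U : set K} :
  dense (range e) -> open U -> U `<=` closure (e @` (e @^-1` U)).
Proof.
move=> de oU p Up B; rewrite nbhsE => -[W [oW Wp] WB].
have [|q [UWq [x _ xq]]] := de (U `&` W) _ (openI oU oW); first by exists p.
move: UWq; rewrite -xq => -[Ux Wx]; exists (e x); split.
  by exists x.
exact: WB.
Qed.

(** * Extensions of a map to compactifications *)

Section compactification_extension.
Context {X1 X2 K1 K2 : topologicalType} {e1 : X1 -> K1} {e2 : X2 -> K2}.
Context {f : X1 -> X2} {F : K1 -> K2}.
Hypotheses (ce1 : compactification e1) (ce2 : compactification e2).
Hypotheses (cF : continuous F) (FE : forall x, F (e1 x) = e2 (f x)).

Let cle1 := embedding_continuous (compactification_embedding e1 ce1).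
Let cle2 := embedding_continuous (compactification_embedding e2 ce2).

Let F_closed : closed_map F.
Proof.
by apply: compact_closed_map cF;
  [exact: compactification_compact ce1|exact: compactification_hausdorff ce2].
Qed.

Let image_ext (A : set X1) : F @` (e1 @` A) = e2 @` (f @` A).
Proof.
rewrite (image_comp e1 F) (image_comp f e2).
by apply: eq_imagel => x _; exact: FE.
Qed.

(** The image of the left-hand closure is compact, hence closed, so it catches
    every limit point of [f @` A] in [K2]. *)
Let F_closure (A : set X1) : F @` closure (e1 @` A) = closure (e2 @` (f @` A)).
Proof.
rewrite -image_ext; apply/seteqP; split; first exact: image_closure_sub.
apply: closure_sub_closed; first exact/F_closed.2/closed_closure.
by apply: image_subset; exact: subset_closure.
Qed.

(** A point of [interior (f @^-1` closure V)] outside [closure (f @^-1` V)] has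
    an open neighbourhood [G] that misses [f @^-1` V] and is mapped into
    [closure V]. Extended to [K1], [G] is mapped into the closure of [V], where
    every non-empty open set meets [V]; pulling such a meeting point back to
    [X1] by density puts a point of [G] in [f @^-1` V]. *)
Lemma quasi_open_extension_skeletal : quasi_open F -> skeletal f.
Proof.
move=> [_ qF] V oV x ix; apply: contrapT => nclx.
have [_ eo1] := compactification_embedding e1 ce1.
have [_ eo2] := compactification_embedding e2 ce2.
have [V' oV' VE] := (eo2 V).1 oV.
pose G := (f @^-1` closure V)° `&` ~` closure (f @^-1` V).
have oG : open G.
  apply: openI; first exact: open_interior.
  exact/closed_openC/closed_closure.
have [P oP GE] := (eo1 G).1 oG.
have [|w iw] := qF P oP.
  by exists (e1 x); suff : (e1 @^-1` P) x by []; rewrite -GE.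
have FPV : F @` P `<=` closure (e2 @` V).
  apply: (@subset_trans _ (F @` closure (e1 @` (e1 @^-1` P)))).
    by apply: image_subset; apply: open_sub_closure_trace oP; case: ce1.
  rewrite -GE F_closure; apply: closure_sub_closed; first exact: closed_closure.
  apply: subset_trans (image_closure_sub cle2); apply: image_subset.
  by apply/image_subP => z [/interior_subset].
have [|y [Wy [v Vv vy]]] :=
    open_meets_closure (A := e2 @` V) (open_interior (F @` P)).
  by exists w; split=> //; apply: FPV; exact: interior_subset.
have [u Pu Fu] := interior_subset Wy.
have oFV' : open (F @^-1` V') by apply: open_comp oV' => ? _; exact: cF.
have [|q [PV'q [z _ zq]]] :=
    compactification_dense e1 ce1 (P `&` F @^-1` V') _ (openI oP oFV').
  by exists u; split=> //=; rewrite Fu -vy; move: Vv; rewrite VE.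
move: PV'q; rewrite -zq => -[Pz V'z]; have [_] : G z by rewrite GE.
by apply; apply: subset_closure; rewrite /= VE /= -FE.
Qed.

(** If a closed neighbourhood [closure G] has an image without interior, the
    complement of that image is open and dense, so its trace [V] is dense in
    [X2]. Skeletality makes [f @^-1` V] dense in [X1], whereas it misses the
    trace of [G]. *)
Lemma skeletal_extension_quasi_open : skeletal f -> quasi_open F.
Proof.
move=> skf; split=> // U oU [p Up].
have [G [oG Gp GU]] := compact_hausdorff_shrink
  (compactification_compact e1 ce1) (compactification_hausdorff e1 ce1) oU Up.
suff [q iq] : (F @` closure G)° !=set0.
  by exists q; apply: interiorS iq; exact: image_subset.
apply/set0P/eqP => i0.
pose V' := ~` (F @` closure G).
have oV' : open V' by exact/closed_openC/F_closed.2/closed_closure.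
have clV' : closure V' = setT by rewrite closure_setC i0 setC0.
pose V := e2 @^-1` V'.
have oV : open V by apply: open_comp oV' => ? _; exact: cle2.
have clV : closure V = setT.
  apply/seteqP; split=> // y _ B; rewrite nbhsE => -[W [oW Wy] WB].
  (* [X2] is dense in [K2] and [V'] is open, so [V'] meets [W'] inside [X2]. *)
  have [_ eo2] := compactification_embedding e2 ce2.
  have [W' oW' WE] := (eo2 W).1 oW.
  have [|z [W'z V'z]] := open_meets_closure (A := V') oW'.
    by exists (e2 y); rewrite clV'; split=> //; move: Wy; rewrite WE.
  have [|q [W'V'q [t _ tq]]] :=
    compactification_dense e2 ce2 (W' `&` V') _ (openI oW' oV').
    by exists z.
  move: W'V'q; rewrite -tq => -[W't V't]; exists t; split=> //.
  by apply: WB; rewrite WE.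
have [|q [Gq [x _ xq]]] := compactification_dense e1 ce1 G _ oG.
  by exists p.
have Gx : G (e1 x) by rewrite xq.
have oG1 : open (e1 @^-1` G) by apply: open_comp oG => ? _; exact: cle1.
have [|z [Gz]] := open_meets_closure (A := f @^-1` V) oG1.
  exists x; split=> //.
  by apply: skf => //; rewrite clV preimage_setT interiorT.
by apply; exists (e1 z); [exact: subset_closure|exact: FE].
Qed.

(** From left to right: [F] maps the complement [U] of the closure of [B] onto
    an open set that contains the closure of [f @` A] and misses
    [~` closure (f @` (~` B))], hence its closure. From right to left: shrink
    [U] twice around [p], to [D] and then to [A'], and apply the hypothesis to
    the traces of [A'] and [~` D]. The image under [F] of the closure of the
    trace of [D] is closed and contains the neighbourhood of [F p] that the
    hypothesis provides. *)
Lemma open_extension_farP : open_map F <->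
  forall A B : set X1, far e1 A B ->
    far e2 (f @` A) (~` closure (f @` (~` B))).
Proof.
split=> [[_ oF] A B AB|OB].
  pose U := ~` closure (e1 @` B).
  have oU : open U by exact/closed_openC/closed_closure.
  apply/disjoints_subset; rewrite -F_closure.
  apply: (@subset_trans _ (F @` U)); first exact/image_subset/disjoints_subset.
  apply/disjoints_subset/eqP; rewrite -[_ == _]negbK; apply/negP => /set0P.
  move=> /(open_meets_closure (oF _ oU))[v [FUv [y ny yv]]].
  have [_ eo2] := compactification_embedding e2 ce2.
  have [|W oW WE] := (eo2 (~` closure (f @` (~` B)))).1.
    exact/closed_openC/closed_closure.
  case: FUv => u Uu Fu.
  have oFW : open (F @^-1` W) by apply: open_comp oW => ? _; exact: cF.
  have [|q [UWq [z _ zq]]] :=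
      compactification_dense e1 ce1 (U `&` F @^-1` W) _ (openI oU oFW).
    by exists u; split=> //=; rewrite Fu -yv; move: ny; rewrite WE.
  move: UWq; rewrite -zq => -[Uz Wz].
  have : (~` closure (f @` (~` B))) (f z) by rewrite WE /= -FE.
  apply; apply: subset_closure; exists z => // Bz.
  by apply: Uz; apply: subset_closure; exists z.
split=> // U oU; rewrite openE => _ [p Up <-].
have shrink := @compact_hausdorff_shrink _ p _
  (compactification_compact e1 ce1) (compactification_hausdorff e1 ce1).
have [D [oD Dp DU]] := shrink U oU Up.
have [A' [oA' A'p A'D]] := shrink D oD Dp.
pose A := e1 @^-1` A'; pose B := e1 @^-1` (~` D).
have farAB : far e1 A B.
  apply/disjoints_subset; apply: (@subset_trans _ D).
    apply: subset_trans A'D; apply: closureS.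
    exact: image_preimage_subset.
  apply: subsetCr; apply: closure_sub_closed; first exact: open_closedC.
  exact: image_preimage_subset.
pose N := ~` closure (e2 @` (~` closure (f @` (~` B)))).
have oN : open N by exact/closed_openC/closed_closure.
have Np : N (F p).
  apply: ((disjoints_subset _ _).1 (OB A B farAB)); rewrite -F_closure.
  exists p => //.
  exact: open_sub_closure_trace (compactification_dense e1 ce1) oA' _ A'p.
(* The trace of [N] lies in [closure (f @` (~` B))], and [~` B] is the trace of
   [D], whose closure stays inside [U]. *)
have NU : N `<=` F @` U.
  have clN := open_sub_closure_trace (compactification_dense e2 ce2) oN.
  apply: (subset_trans clN).
  apply: (@subset_trans _ (F @` closure (e1 @` (~` B)))).
    rewrite F_closure; apply: closure_sub_closed; first exact: closed_closure.
    apply: subset_trans (image_closure_sub cle2); apply: image_subset => y Ny.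
    apply: contrapT => ny; apply: Ny; apply: subset_closure.
    by exists y.
  apply: image_subset; apply: subset_trans DU; apply: closureS.
  by move=> _ [x nBx <-]; apply: contrapT => nD; exact: nBx.
by apply: filterS NU _; exact: open_nbhs_nbhs.
Qed.

End compactification_extension.

(** * Complete separation *)

Lemma completely_separated_closure {R : realType} {X : topologicalType}
    {A B : set X} :
  completely_separated R A B -> closure A `&` closure B = set0.
Proof.
move=> [h [ch _ h0 h1]].
have cl1 (r : R) : closed (h @^-1` [set r]).
  apply: (@preimage_closed X R h [set r]) => [x _|]; first exact: ch.
  exact/accessible_closed_set1/hausdorff_accessible/Rhausdorff.
have sub r C : h @` C `<=` [set r] -> closure C `<=` h @^-1` [set r].
  by move=> /image_subP hC; exact: closure_sub_closed (cl1 r) hC.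
apply/disjoints_subset => x /(sub _ _ h0)/= hx0 /(sub _ _ h1)/= hx1.
by move/eqP: hx1; rewrite hx0 eq_sym GRing.oner_eq0.
Qed.

(** Urysohn's lemma gives the separating function. *)
Lemma normal_completely_separatedP (R : realType) {X : topologicalType} :
  normal_space X -> forall A B : set X,
  completely_separated R A B <-> closure A `&` closure B = set0.
Proof.
move=> /(@normal_separatorP R) nX A B.
split=> [|AB]; first exact: completely_separated_closure.
have /(@uniform_separatorP _ R)[h [ch h01 h0 h1]] :=
  nX _ _ (@closed_closure _ A) (@closed_closure _ B) AB.
exists h; split=> // _ [x Cx <-].
  by apply: h0; exists x => //; exact: subset_closure.
by apply: h1; exists x => //; exact: subset_closure.
Qed.

Lemma completely_separated_preimage {R : realType} {X Y : topologicalType}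
    {g : X -> Y} {A B : set X} : continuous g ->
  completely_separated R (g @` A) (g @` B) -> completely_separated R A B.
Proof.
move=> cg [h [ch h01 h0 h1]]; exists (h \o g); split.
- by move=> x; apply: continuous_comp; [exact: cg|exact: ch].
- by move=> _ [x _ <-]; apply: h01; exists (g x).
- by rewrite -(image_comp g h).
- by rewrite -(image_comp g h).
Qed.

(** The universal property applies to maps into compact spaces, so the
    separating function is first corestricted to the unit interval. *)
Lemma completely_separated_extend {R : realType} {X K : topologicalType}
    {e : X -> K} {A B : set X} : stone_cech e ->
  completely_separated R A B -> completely_separated R (e @` A) (e @` B).
Proof.
move=> [_ _ _ _ ext] [h [ch h01 h0 h1]].
have hI x : h x \in `[0%R, 1%R]%classic by apply/mem_set/h01; exists x.
pose I := set_type (`[0%R, 1%R]%classic : set R).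
pose g x : I := exist _ (h x) (hI x).
have cg : continuous g.
  apply/continuousP => _ [W oW <-].
  by have /continuousP := ch; exact.
have [||G cG GE] := ext I g _ _ cg.
- exact/set_type_compact/segment_compact.
- exact/set_type_hausdorff/Rhausdorff.
exists (set_val \o G); split.
- move=> x; apply: continuous_comp; first exact: cG.
  exact: initial_continuous.
- by move=> _ [x _ <-]; apply: set_mem; exact: (valP (G x)).
- apply/image_subP => _ [x Ax <-] /=; rewrite GE.
  by apply: (h0 (h x)); exists x.
- apply/image_subP => _ [x Bx <-] /=; rewrite GE.
  by apply: (h1 (h x)); exists x.
Qed.

(** [K] is normal, so far sets are separated by a function on [K], which
    restricts to [X]. *)
Lemma stone_cech_farP (R : realType) {X K : topologicalType} {e : X -> K} :
  stone_cech e -> forall A B : set X, completely_separated R A B <-> far e A B.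
Proof.
move=> sce A B.
have nK := compact_normal (stone_cech_hausdorff sce) (stone_cech_compact sce).
have sepP := normal_completely_separatedP R nK (e @` A) (e @` B).
split=> [/(completely_separated_extend sce)/sepP//|/sepP].
apply: completely_separated_preimage.
exact/embedding_continuous/stone_cech_embedding.
Qed.

(** * Normal spaces and the theorem *)

(** Both conditions say the same about [B] and its complement: [closure A] and
    [closure B] are disjoint iff [closure A] lies in the interior of [~` B]. *)
Lemma far_preservation_closure_interior {X Y : topologicalType} (f : X -> Y) :
  (forall A B : set X, closure A `&` closure B = set0 ->
    closure (f @` A) `&` closure (~` closure (f @` (~` B))) = set0) <->
  (forall A B : set X, closure A `<=` B° ->
    closure (f @` A) `<=` (closure (f @` B))°).
Proof.
split=> H A B AB.
  have := H A (~` B); rewrite !closure_setC setCK => /(_ _)/disjoints_subset.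
  by rewrite setCK; apply; apply/disjoints_subset; rewrite setCK.
apply/disjoints_subset; rewrite closure_setC setCK; apply: H.
by rewrite interiorC; exact/disjoints_subset.
Qed.

Lemma open_closed_map_closure_interior {X Y : topologicalType} {f : X -> Y} :
  open_map f -> closed_map f -> forall A B : set X, closure A `<=` B° ->
  closure (f @` A) `<=` (closure (f @` B))°.
Proof.
move=> [_ of_] [_ cf] A B AB.
apply: (@subset_trans _ (f @` B°)); last first.
  rewrite -open_subsetE; last exact/of_/open_interior.
  apply: subset_trans (@subset_closure _ _).
  by apply: image_subset; exact: interior_subset.
apply: (@subset_trans _ (f @` closure A)); last exact: image_subset.
apply: closure_sub_closed; first by apply: cf; exact: closed_closure.
by apply: image_subset; exact: subset_closure.
Qed.

Theorem corollary3p7 (R : realType) (X1 X2 : topologicalType)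
    (tX1 : tychonoff_space X1) (tX2 : tychonoff_space X2)
    (f : X1 -> X2) (cf : continuous f)
    (bX1 bX2 : topologicalType) (e1 : X1 -> bX1) (e2 : X2 -> bX2)
    (sc1 : stone_cech e1) (sc2 : stone_cech e2)
    (bf : bX1 -> bX2) (bfE : stone_cech_extension e1 e2 f bf) :
  [/\ (quasi_open bf <-> skeletal f),
      (open_map bf <->
        forall A B : set X1, completely_separated R A B ->
          completely_separated R (f @` A) (~` closure (f @` (~` B)))),
      (normal_space X1 -> normal_space X2 ->
        (open_map bf <->
          forall A B : set X1, closure A `<=` interior B ->
            closure (f @` A) `<=` interior (closure (f @` B))))
    & (normal_space X1 -> normal_space X2 ->
        open_map f -> closed_map f -> open_map bf)].
Proof.
have [cbf bfe] := bfE.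
have c1 := stone_cech_compactification sc1.
have c2 := stone_cech_compactification sc2.
have openP : open_map bf <->
    forall A B : set X1, completely_separated R A B ->
      completely_separated R (f @` A) (~` closure (f @` (~` B))).
  split=> [/(open_extension_farP c1 c2 cbf bfe) OB A B|OB].
    by move=> /(stone_cech_farP R sc1)/OB/(stone_cech_farP R sc2).
  apply/(open_extension_farP c1 c2 cbf bfe) => A B.
  by move=> /(stone_cech_farP R sc1)/OB/(stone_cech_farP R sc2).
have normalP : normal_space X1 -> normal_space X2 -> (open_map bf <->
    forall A B : set X1, closure A `<=` interior B ->
      closure (f @` A) `<=` interior (closure (f @` B))).
  move=> n1 n2; rewrite openP -far_preservation_closure_interior.
  have sep1 := normal_completely_separatedP R n1.
  have sep2 := normal_completely_separatedP R n2.
  by split=> OB A B /sep1/OB/sep2.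
split=> //; first split.
- exact: quasi_open_extension_skeletal c1 c2 cbf bfe.
- exact: skeletal_extension_quasi_open c1 c2 cbf bfe.
- move=> n1 n2 of_ clf; apply/(normalP n1 n2).
  exact: open_closed_map_closure_interior.
Qed.
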